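(* Let $n \ge 1$ and let $(M,\phi,\xi,\eta,g)$ be a $(2n+1)$-dimensional Kenmotsu manifold with Levi-Civita connection $\nabla$. Equip $M$ with the non-symmetric non-metric connection $\tilde{\nabla}$ defined by $\tilde{\nabla}_X Y = \nabla_X Y - \eta(Y)X - g(X,Y)\xi$ for all vector fields $X,Y$ on $M$. Then $M$ is irregular with respect to $\tilde{\nabla}$; that is, the curvature tensor $\tilde{R}$ of $\tilde{\nabla}$ satisfies $\tilde{R}(X,Y)\xi = 0$ for all vector fields $X,Y$ on $M$.
   Context: An almost contact metric manifold is a smooth manifold $M$ of dimension $2n+1$ with a $(1,1)$-tensor field $\phi$, a vector field $\xi$, a 1-form $\eta$ and a Riemannian metric $g$ such that $\phi^2 = -I + \eta\otimes\xi$, $\eta(\xi)=1$ and $g(\phi X,\phi Y) = g(X,Y)-\eta(X)\eta(Y)$ for all vector fields $X,Y$ (consequently $\eta(X)=g(X,\xi)$). It is called a Kenmotsu manifold if in addition $\nabla_X\xi = X-\eta(X)\xi$ for all vector fields $X$, equivalently $(\nabla_X\eta)(Y) = g(X,Y)-\eta(X)\eta(Y)$, where $\nabla$ is the Levi-Civita connection of $g$. The curvature tensor of $\tilde{\nabla}$ is $\tilde{R}(X,Y)Z = \tilde{\nabla}_X\tilde{\nabla}_Y Z - \tilde{\nabla}_Y\tilde{\nabla}_X Z - \tilde{\nabla}_{[X,Y]}Z$. The manifold $M$ is called irregular with respect to $\tilde{\nabla}$ if $\tilde{R}(X,Y)\xi=0$ for all vector fields $X,Y$. *)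

(* Defs.v *)
From HB Require Import structures.
From mathcomp Require Import all_boot all_order all_algebra.
From mathcomp Require Import boolp classical_sets functions reals.
From mathcomp Require Import topology normedtype derive ring.

Set Implicit Arguments.
Unset Strict Implicit.
Unset Printing Implicit Defensive.

Import Order.TTheory GRing.Theory Num.Theory.
Import numFieldNormedType.Exports.

Local Open Scope classical_set_scope.
Local Open Scope ring_scope.

Lemma near_eq_open (T : topologicalType) (S : Type) (U : set T) (f g : T -> S)
  (x : T) : open U -> {in U, f =1 g} -> U x -> {near x, f =1 g}.
Proof.
move=> oU e Ux; have : nbhs x U by exact: open_nbhs_nbhs.
by apply: filterS => y Uy; apply: e; rewrite inE.
Qed.

Lemma continuous_eq_open (T S : topologicalType) (U : set T) (f g : T -> S) :
  open U -> {in U, f =1 g} -> {in U, continuous f} -> {in U, continuous g}.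
Proof.
move=> oU e cf x xU; rewrite /continuous_at -(e x xU).
apply: cvg_trans (cf x xU); apply: near_eq_cvg.
by apply: near_eq_open oU e _; rewrite inE in xU.
Qed.

Section Ck.
Context {R : realType} {m : nat}.
Implicit Types (U : set 'rV[R]_m) (f g : 'rV[R]_m -> R) (k : nat).

(* f is C^k on the open set U: all iterated partial derivatives of order at
   most k exist and are continuous on U. *)
Fixpoint Ck_on U k f : Prop :=
  {in U, continuous f} /\
  if k is k'.+1 then
    forall i : 'I_m, (forall x, U x -> derivable f x 'e_i) /\
                     Ck_on U k' (fun x => 'D_'e_i f x)
  else True.

Definition smooth_on U f : Prop := forall k, Ck_on U k f.

Lemma Ck_on_cont U k f : Ck_on U k f -> {in U, continuous f}.
Proof. by case: k => [|k] []. Qed.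

Lemma Ck_onW U k f : Ck_on U k.+1 f -> Ck_on U k f.
Proof.
elim: k f => [|k IH] f; first by case.
move=> [cf /= df]; split=> // i; have [dfi ddfi] := df i.
by split=> //; apply: IH.
Qed.

Lemma Ck_on_eq U k f g : open U -> {in U, f =1 g} -> Ck_on U k f -> Ck_on U k g.
Proof.
move=> oU; elim: k f g => [|k IH] f g e [cf df].
  by split=> //; exact: continuous_eq_open cf.
split; first exact: continuous_eq_open cf.
move=> i; have [dfi ddfi] := df i; split.
  by move=> x Ux; apply: near_eq_derivable (dfi x Ux); exact: near_eq_open Ux.
apply: IH ddfi => x; rewrite inE => Ux; apply: near_eq_derive.
exact: near_eq_open Ux.
Qed.

Lemma Ck_on_cst U k (a : R) : Ck_on U k (cst a).
Proof.
have cc (b : R) : {in U, continuous (cst b : 'rV[R]_m -> R)}.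
  by move=> x _; exact: cst_continuous.
elim: k a => [|k IH] a; split=> //.
move=> i; split=> [x _|]; first exact: derivable_cst.
have -> : (fun x => 'D_'e_i (cst a : 'rV[R]_m -> R) x) = cst 0.
  by rewrite funeqE => x; rewrite derive_cst.
exact: IH.
Qed.

Lemma Ck_onD U k f g :
  open U -> Ck_on U k f -> Ck_on U k g -> Ck_on U k (f + g).
Proof.
move=> oU; elim: k f g => [|k IH] f g [cf df] [cg dg].
  by split=> // x xU; apply: continuousD; [exact: cf|exact: cg].
split; first by move=> x xU; apply: continuousD; [exact: cf|exact: cg].
move=> i; have [dfi ddfi] := df i; have [dgi ddgi] := dg i; split.
  by move=> x Ux; apply: derivableD; [exact: dfi|exact: dgi].
apply: Ck_on_eq (IH _ _ ddfi ddgi) => // x; rewrite inE => Ux.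
by rewrite deriveD //; [exact: dfi|exact: dgi].
Qed.

Lemma Ck_onM U k f g :
  open U -> Ck_on U k f -> Ck_on U k g -> Ck_on U k (f * g).
Proof.
move=> oU; elim: k f g => [|k IH] f g Cf Cg; have [cf df] := Cf;
  have [cg dg] := Cg.
  by split=> // x xU; apply: continuousM; [exact: cf|exact: cg].
split; first by move=> x xU; apply: continuousM; [exact: cf|exact: cg].
move=> i; have [dfi ddfi] := df i; have [dgi ddgi] := dg i; split.
  by move=> x Ux; apply: derivableM; [exact: dfi|exact: dgi].
have H1 := IH _ _ (Ck_onW Cf) ddgi; have H2 := IH _ _ (Ck_onW Cg) ddfi.
apply: Ck_on_eq (Ck_onD oU H1 H2) => // x; rewrite inE => Ux.
by rewrite deriveM //; [exact: dfi|exact: dgi].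
Qed.

End Ck.

Section manifold.
Variable R : realType.

Record chart (m : nat) (M : topologicalType) := Chart {
  chart_dom : set M;
  chart_map :> M -> 'rV[R]_m;
  chart_inv : 'rV[R]_m -> M;
  chart_dom_open : open chart_dom;
  chart_img_open : open (chart_map @` chart_dom);
  chart_mapK : {in chart_dom, cancel chart_map chart_inv};
  chart_map_continuous : {in chart_dom, continuous chart_map};
  chart_inv_continuous : {in chart_map @` chart_dom, continuous chart_inv} }.

Definition smooth_compatible m (M : topologicalType) (c c' : chart m M) :=
  forall j, smooth_on (c @` (chart_dom c `&` chart_dom c'))
                      (fun y => c' (chart_inv c y) 0 j).

(* The smooth structure is presented by an atlas, not necessarily maximal. *)
Record manifold (m : nat) := Manifold {
  manifold_carrier :> topologicalType;
  manifold_hausdorff : hausdorff_space manifold_carrier;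
  manifold_second_countable : @second_countable manifold_carrier;
  atlas : set (chart m manifold_carrier);
  atlas_cover : forall p, exists2 c, atlas c & chart_dom c p;
  atlas_compatible :
    forall c c', atlas c -> atlas c' -> smooth_compatible c c' }.

End manifold.

Section smooth_functions.
Context {R : realType} {m : nat} (M : manifold R m).

Definition smooth : {pred M -> R} := mem [set f : M -> R |
  forall c, atlas c -> smooth_on (c @` chart_dom c) (f \o chart_inv c)].

Lemma smooth_subring_closed : subring_closed smooth.
Proof.
have cst_smooth (a : R) : cst a \in smooth.
  by rewrite inE => c _ k; exact: Ck_on_cst.
have smoothM : {in smooth &, forall f g, f * g \in smooth}.
  move=> f g; rewrite !inE => sf sg c ca k.
  by have := Ck_onM (@chart_img_open _ _ _ c) (sf c ca k) (sg c ca k).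
split; [exact: (cst_smooth 1)|move=> f g sf sg|exact: smoothM].
have -> : f - g = f + cst (- 1) * g by apply/funext => x /=; rewrite /= mulN1r.
have := smoothM _ _ (cst_smooth (- 1)) sg.
move: sf; rewrite !inE => sf sg' c ca k.
by have := Ck_onD (@chart_img_open _ _ _ c) (sf c ca k) (sg' c ca k).
Qed.

Lemma smooth_scaler_closed : scaler_closed (smooth : {pred M -> R^o}).
Proof.
move=> a f; rewrite !inE => sf c ca k.
by have := Ck_onM (@chart_img_open _ _ _ c) (Ck_on_cst _ _ a) (sf c ca k).
Qed.

HB.instance Definition _ := GRing.isSubringClosed.Build (M -> R) smooth
  smooth_subring_closed.
HB.instance Definition _ := GRing.isScaleClosed.Build R (M -> R^o) smooth
  smooth_scaler_closed.

Record smooth_fun := SmoothFun {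
  smooth_fun_val :> M -> R;
  smooth_funP : smooth_fun_val \in smooth }.

HB.instance Definition _ := [isSub for smooth_fun_val].
HB.instance Definition _ := [Choice of smooth_fun by <:].
HB.instance Definition _ := GRing.SubChoice_isSubComPzRing.Build
  (M -> R) smooth smooth_fun (GRing.subringClosedP _).

HB.instance Definition _ := GRing.SubZmodule_isSubLmodule.Build
  R (M -> R^o) smooth smooth_fun (GRing.subsemimodClosedP _).

Lemma smooth_fun_ext (f g : smooth_fun) : f =1 g -> f = g.
Proof. by move=> fg; apply: val_inj; apply/funext. Qed.

End smooth_functions.

Arguments smooth {R m} M.

Section vector_fields.
Context {R : realType} {m : nat} (M : manifold R m).
Local Notation C := (smooth_fun M).

Definition derivation_at (p : M) : {pred C -> R^o} := mem [set v : C -> R^o |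
  (forall (a : R) (f g : C), v (a *: f + g) = a * v f + v g) /\
  (forall f g : C, v (f * g) = f p * v g + g p * v f)].

Lemma derivation_at_submod_closed p : submod_closed (derivation_at p).
Proof.
split; first by rewrite inE; split=> * /=; rewrite !mulr0 addr0.
move=> a u v; rewrite !inE => -[u1 u2] [v1 v2].
have E h : (a *: u + v) h = a * u h + v h by [].
by split=> [b f g|f g]; rewrite !E ?(u1, v1, u2, v2); ring.
Qed.

HB.instance Definition _ p := GRing.isSubmodClosed.Build R (C -> R^o)
  (derivation_at p) (derivation_at_submod_closed p).

(* T_p M as the space of derivations of C^oo(M) at p; M being Hausdorff, bump
   functions make this the same as derivations of germs at p. *)
Record tangent (p : M) := Tangent {
  tangent_val :> C -> R^o;
  tangentP : tangent_val \in derivation_at p }.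

HB.instance Definition _ p := [isSub for @tangent_val p].
HB.instance Definition _ p := [Choice of tangent p by <:].
HB.instance Definition _ p := [SubChoice_isSubLmodule of tangent p by <:].

Record vector_field := VectorField {
  vector_at :> forall p, tangent p;
  vector_smooth : forall f : C, (fun p => vector_at p f) \in smooth M }.

Lemma tangent_linear p (v : tangent p) (a : R) (f g : C) :
  v (a *: f + g) = a * v f + v g.
Proof. by have := tangentP v; rewrite inE => -[]. Qed.

Lemma tangent_leibniz p (v : tangent p) (f g : C) :
  v (f * g) = f p * v g + g p * v f.
Proof. by have := tangentP v; rewrite inE => -[]. Qed.

Lemma tangent_ext p (u v : tangent p) : (forall f, u f = v f) -> u = v.
Proof. by move=> uv; apply: val_inj; apply/funext. Qed.

Lemma vector_field_ext (X Y : vector_field) : (forall p, X p = Y p) -> X = Y.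
Proof.
case: X Y => [X sX] [Y sY] /= XY.
have E : X = Y by exact: functional_extensionality_dep.
by case: _ / E in sY *; congr VectorField; exact: Prop_irrelevance.
Qed.

HB.instance Definition _ := gen_eqMixin vector_field.
HB.instance Definition _ := gen_choiceMixin vector_field.

(* The function X f. *)
Definition lie (X : vector_field) (f : C) : C := SmoothFun (vector_smooth X f).

Fact zero_vector_smooth (f : C) : (fun p => (0 : tangent p) f) \in smooth M.
Proof. exact: rpred0. Qed.
Definition zero_vector : vector_field := VectorField zero_vector_smooth.

Fact opp_vector_smooth (X : vector_field) (f : C) :
  (fun p => (- X p) f) \in smooth M.
Proof. by have := rpredNr (vector_smooth X f). Qed.
Definition opp_vector X : vector_field := VectorField (opp_vector_smooth X).

Fact add_vector_smooth (X Y : vector_field) (f : C) :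
  (fun p => (X p + Y p) f) \in smooth M.
Proof. by have := rpredD (vector_smooth X f) (vector_smooth Y f). Qed.
Definition add_vector X Y : vector_field := VectorField (add_vector_smooth X Y).

Fact scale_vector_smooth (h : C) (X : vector_field) (f : C) :
  (fun p => (h p *: X p) f) \in smooth M.
Proof. by have := rpredM (smooth_funP h) (vector_smooth X f). Qed.
Definition scale_vector h X : vector_field :=
  VectorField (scale_vector_smooth h X).

Fact add_vectorA : associative add_vector.
Proof. by move=> X Y Z; apply: vector_field_ext => p; exact: addrA. Qed.
Fact add_vectorC : commutative add_vector.
Proof. by move=> X Y; apply: vector_field_ext => p; exact: addrC. Qed.
Fact add0_vector : left_id zero_vector add_vector.
Proof. by move=> X; apply: vector_field_ext => p; exact: add0r. Qed.
Fact addN_vector : left_inverse zero_vector opp_vector add_vector.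
Proof. by move=> X; apply: vector_field_ext => p; exact: addNr. Qed.

HB.instance Definition _ := GRing.isZmodule.Build vector_field
  add_vectorA add_vectorC add0_vector addN_vector.

Fact scale_vectorA (f g : C) X :
  scale_vector f (scale_vector g X) = scale_vector (f * g) X.
Proof. by apply: vector_field_ext => p; exact: scalerA. Qed.
Fact scale1_vector : left_id 1 scale_vector.
Proof. by move=> X; apply: vector_field_ext => p; exact: scale1r. Qed.
Fact scale_vectorDr : right_distributive scale_vector +%R.
Proof. by move=> f X Y; apply: vector_field_ext => p; exact: scalerDr. Qed.
Fact scale_vectorDl X : {morph scale_vector^~ X : f g / f + g}.
Proof. by move=> f g; apply: vector_field_ext => p; exact: scalerDl. Qed.

HB.instance Definition _ := GRing.Zmodule_isLmodule.Build C vector_field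
  scale_vectorA scale1_vector scale_vectorDr scale_vectorDl.

(* The Lie bracket [X, Y] f = X (Y f) - Y (X f). *)
Fact bracket_derivation (X Y : vector_field) (p : M) :
  (fun f => X p (lie Y f) - Y p (lie X f)) \in derivation_at p.
Proof.
have lieD Z (a : R) (f g : C) : lie Z (a *: f + g) = a *: lie Z f + lie Z g.
  by apply: smooth_fun_ext => q /=; rewrite tangent_linear.
have lieM Z (f g : C) : lie Z (f * g) = f * lie Z g + g * lie Z f.
  by apply: smooth_fun_ext => q /=; rewrite tangent_leibniz.
have addE (Z : vector_field) (f g : C) : Z p (f + g) = Z p f + Z p g :> R.
  by have := tangent_linear (Z p) 1 f g; rewrite scale1r mul1r.
rewrite inE; split=> [a f g|f g].
  by rewrite !lieD !tangent_linear; ring.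
by rewrite !lieM !addE !tangent_leibniz /=; ring.
Qed.

Fact bracket_smooth (X Y : vector_field) (f : C) :
  (fun p => Tangent (bracket_derivation X Y p) f) \in smooth M.
Proof.
have XY := smooth_funP (lie X (lie Y f)).
by have := rpredB XY (smooth_funP (lie Y (lie X f))).
Qed.

Definition bracket (X Y : vector_field) : vector_field :=
  VectorField (bracket_smooth X Y).

End vector_fields.

Section tensors.
Context {R : realType} {m : nat} (M : manifold R m).
Local Notation C := (smooth_fun M).
Local Notation VF := (vector_field M).

(* A tensor field is a family of multilinear maps on the tangent spaces; it is
   smooth iff it sends smooth vector fields to smooth functions (resp. vector
   fields), which by bump functions agrees with smoothness of components. *)

Record one_form := OneForm {
  one_form_at :> forall p : M, tangent p -> R;
  one_form_linear : forall p (a : R) (u v : tangent p),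
    one_form_at (a *: u + v) = a * one_form_at u + one_form_at v;
  one_form_smooth : forall X : VF, (fun p => one_form_at (X p)) \in smooth M }.

Definition form_app (w : one_form) (X : VF) : C :=
  SmoothFun (one_form_smooth w X).

Record tensor11 := Tensor11 {
  tensor11_at :> forall p : M, tangent p -> tangent p;
  tensor11_linear : forall p (a : R) (u v : tangent p),
    tensor11_at (a *: u + v) = a *: tensor11_at u + tensor11_at v;
  tensor11_smooth : forall (X : VF) (f : C),
    (fun p => tensor11_at (X p) f) \in smooth M }.

Definition tensor_app (phi : tensor11) (X : VF) : VF :=
  VectorField (tensor11_smooth phi X).

Record riemannian_metric := RiemannianMetric {
  metric_at :> forall p : M, tangent p -> tangent p -> R;
  metric_linear : forall p (a : R) (u v w : tangent p),
    metric_at (a *: u + v) w = a * metric_at u w + metric_at v w;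
  metric_symmetric : forall p (u v : tangent p), metric_at u v = metric_at v u;
  metric_pos : forall p (v : tangent p), v != 0 -> 0 < metric_at v v;
  metric_smooth : forall X Y : VF,
    (fun p => metric_at (X p) (Y p)) \in smooth M }.

Definition metric_app (g : riemannian_metric) (X Y : VF) : C :=
  SmoothFun (metric_smooth g X Y).

(* Affine (Koszul) connections; the first argument is the direction. *)
Record connection := Connection {
  nabla :> VF -> VF -> VF;
  nabla_linear : forall (f : C) (X Y Z : VF),
    nabla (f *: X + Y) Z = f *: nabla X Z + nabla Y Z;
  nabla_additive : forall X Y Z : VF, nabla X (Y + Z) = nabla X Y + nabla X Z;
  nabla_leibniz : forall (f : C) (X Y : VF),
    nabla X (f *: Y) = f *: nabla X Y + lie X f *: Y }.

Definition curvature (D : connection) (X Y Z : VF) : VF :=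
  D X (D Y Z) - D Y (D X Z) - D (bracket X Y) Z.

Definition torsion_free (D : connection) : Prop :=
  forall X Y : VF, D X Y - D Y X = bracket X Y.

Definition metric_compatible (g : riemannian_metric) (D : connection) : Prop :=
  forall X Y Z : VF, lie X (metric_app g Y Z) =
    metric_app g (D X Y) Z + metric_app g Y (D X Z).

Definition levi_civita (g : riemannian_metric) (D : connection) : Prop :=
  torsion_free D /\ metric_compatible g D.

End tensors.

Section kenmotsu.
Context {R : realType} {n : nat} (M : manifold R (2 * n + 1)%N).
Local Notation VF := (vector_field M).

Record almost_contact_metric := AlmostContactMetric {
  acm_phi : tensor11 M;
  acm_xi : VF;
  acm_eta : one_form M;
  acm_g : riemannian_metric M;
  acm_phi2 : forall X : VF,
    tensor_app acm_phi (tensor_app acm_phi X) =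
    - X + form_app acm_eta X *: acm_xi;
  acm_eta_xi : form_app acm_eta acm_xi = 1;
  acm_g_phi : forall X Y : VF,
    metric_app acm_g (tensor_app acm_phi X) (tensor_app acm_phi Y) =
    metric_app acm_g X Y - form_app acm_eta X * form_app acm_eta Y }.

(* The Levi-Civita connection is characterised rather than constructed; it is
   the unique D satisfying levi_civita. *)
Definition kenmotsu (S : almost_contact_metric) : Prop :=
  forall D : connection M, levi_civita (acm_g S) D ->
  forall X : VF, D X (acm_xi S) = X - form_app (acm_eta S) X *: acm_xi S.

Definition irregular (S : almost_contact_metric) (D : connection M) : Prop :=
  forall X Y : VF, curvature D X Y (acm_xi S) = 0.

Section tilde.
Variables (S : almost_contact_metric) (D : connection M).
Local Notation xi := (acm_xi S).
Local Notation eta := (form_app (acm_eta S)).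
Local Notation g := (metric_app (acm_g S)).

Definition tilde_nabla (X Y : VF) : VF := D X Y - eta Y *: X - g X Y *: xi.

Fact etaP f X Y : eta (f *: X + Y) = f * eta X + eta Y.
Proof. by apply: smooth_fun_ext => p; exact: one_form_linear. Qed.

Fact gP f X Y Z : g (f *: X + Y) Z = f * g X Z + g Y Z.
Proof. by apply: smooth_fun_ext => p; exact: metric_linear. Qed.

Fact gC X Y : g X Y = g Y X.
Proof. by apply: smooth_fun_ext => p; exact: metric_symmetric. Qed.

Fact subDD (V : zmodType) (a b c a' b' c' : V) :
  a + a' - (b + b') - (c + c') = (a - b - c) + (a' - b' - c').
Proof. by rewrite !opprD [RHS]addrACA; congr (_ + _); rewrite addrACA. Qed.

Fact tilde_nabla_linear f X Y Z :
  tilde_nabla (f *: X + Y) Z = f *: tilde_nabla X Z + tilde_nabla Y Z.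
Proof.
rewrite /tilde_nabla nabla_linear gP scalerDr scalerDl subDD !scalerBr !scalerA.
by rewrite (mulrC f (eta Z)).
Qed.

Fact tilde_nabla_additive X Y Z :
  tilde_nabla X (Y + Z) = tilde_nabla X Y + tilde_nabla X Z.
Proof.
have eD := etaP 1 Y Z; have gD := gP 1 Y Z X.
rewrite !scale1r !mul1r in eD gD.
by rewrite /tilde_nabla nabla_additive eD gC gD !scalerDl subDD -!(gC X).
Qed.

Fact tilde_nabla_leibniz f X Y :
  tilde_nabla X (f *: Y) = f *: tilde_nabla X Y + lie X f *: Y.
Proof.
have e0 : eta 0 = 0.
  have := etaP 1 0 0; rewrite scale1r mul1r addr0.
  by move=> /(canLR (addrK _)) <-; rewrite subrr.
have g0 : g 0 X = 0.
  have := gP 1 0 0 X; rewrite scale1r mul1r addr0.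
  by move=> /(canLR (addrK _)) <-; rewrite subrr.
have eZ := etaP f Y 0; have gZ := gP f Y 0 X.
rewrite !addr0 e0 g0 ?addr0 in eZ gZ.
rewrite /tilde_nabla nabla_leibniz eZ gC gZ !scalerBr !scalerA -(gC X).
by rewrite -!addrA; congr (_ + _); rewrite addrC -!addrA.
Qed.

Definition tilde_connection : connection M :=
  Connection tilde_nabla_linear tilde_nabla_additive tilde_nabla_leibniz.

End tilde.
End kenmotsu.

(* Main.v *)
Require Import Defs.
From mathcomp Require Import all_boot all_order all_algebra.
From mathcomp Require Import reals.

(** The connection [tilde_nabla] sends [xi] to [-2 eta(X) xi], so that its
    curvature on [xi] is [-2 d eta(X, Y) xi].  Since [eta = g(-, xi)], metric
    compatibility and vanishing torsion reduce [d eta(X, Y)] to the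
    antisymmetrization of [g(Y, nabla_X xi)], which is symmetric in [X] and [Y]
    on a Kenmotsu manifold. *)

Import GRing.Theory.
Local Open Scope ring_scope.

(** The ring of smooth functions has zero divisors but no nonzero nilpotents, as its values lie in a
    field. *)
Lemma smooth_fun_sqr_eq0 {R : realType} {m : nat} {M : manifold R m}
    (f : smooth_fun M) : f * f = 0 -> f = 0.
Proof.
move=> ff0; apply: smooth_fun_ext => p.
have /eqP : f p * f p = 0 by have := congr1 (fun h : smooth_fun M => h p) ff0.
by rewrite mulf_eq0 orbb => /eqP.
Qed.

Lemma tensor_appP {R : realType} {m : nat} {M : manifold R m}
    (phi : tensor11 M) (f : smooth_fun M) (X Y : vector_field M) :
  tensor_app phi (f *: X + Y) = f *: tensor_app phi X + tensor_app phi Y.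
Proof. by apply: vector_field_ext => p; exact: tensor11_linear. Qed.

Lemma tensor_app0 {R : realType} {m : nat} {M : manifold R m}
    (phi : tensor11 M) : tensor_app phi 0 = 0.
Proof.
have := tensor_appP phi 1 0 0.
by rewrite !scale1r addr0 => /(canLR (addrK _)) <-; rewrite subrr.
Qed.

Lemma lieD {R : realType} {m : nat} {M : manifold R m} (X : vector_field M)
    (f h : smooth_fun M) : lie X (f + h) = lie X f + lie X h.
Proof.
apply: smooth_fun_ext => p /=.
by have := tangent_linear (X p) 1 f h; rewrite scale1r mul1r.
Qed.

Lemma lie0 {R : realType} {m : nat} {M : manifold R m} (X : vector_field M) :
  lie X 0 = 0.
Proof.
have := lieD X 0 0.
by rewrite addr0 => /(canLR (addrK _)) <-; rewrite subrr.
Qed.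

Lemma lieN {R : realType} {m : nat} {M : manifold R m} (X : vector_field M)
    (f : smooth_fun M) : lie X (- f) = - lie X f.
Proof. by apply/eqP; rewrite -addr_eq0 -lieD addNr lie0. Qed.

Section almost_contact.
Context {R : realType} {n : nat} {M : manifold R (2 * n + 1)%N}.
Variable S : almost_contact_metric M.
Local Notation phi := (tensor_app (acm_phi S)).
Local Notation xi := (acm_xi S).
Local Notation eta := (form_app (acm_eta S)).
Local Notation g := (metric_app (acm_g S)).

Lemma eta0 : eta 0 = 0.
Proof.
have := etaP S 1 0 0; rewrite scale1r mul1r addr0.
by move=> /(canLR (addrK _)) <-; rewrite subrr.
Qed.

Lemma etaZ f X : eta (f *: X) = f * eta X.
Proof. by have := etaP S f X 0; rewrite eta0 !addr0. Qed.

Lemma metric0l X : g 0 X = 0.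
Proof.
have := gP S 1 0 0 X; rewrite scale1r mul1r addr0.
by move=> /(canLR (addrK _)) <-; rewrite subrr.
Qed.

Lemma metricZl f X Y : g (f *: X) Y = f * g X Y.
Proof. by have := gP S f X 0 Y; rewrite metric0l !addr0. Qed.

Lemma metricBl X Y Z : g (X - Y) Z = g X Z - g Y Z.
Proof. by have := gP S (-1) Y X Z; rewrite scaleN1r mulN1r ![- _ + _]addrC. Qed.

(** Applying the formula for [phi^2] to [phi xi] gives [phi xi = a xi] with [a = eta (phi xi)]. Then
    [0 = phi (phi xi) = a phi xi], and taking [eta] leaves [a * a = 0]. *)
Lemma phi_xi : phi xi = 0.
Proof.
have phi2_xi : phi (phi xi) = 0.
  by rewrite acm_phi2 acm_eta_xi scale1r addNr.
have phi_xiE : phi xi = eta (phi xi) *: xi.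
  have := acm_phi2 S (phi xi).
  by rewrite phi2_xi tensor_app0 addrC => /esym/subr0_eq.
have aa0 : eta (phi xi) * eta (phi xi) = 0.
  have := tensor_appP (acm_phi S) (eta (phi xi)) xi 0.
  rewrite tensor_app0 !addr0 -phi_xiE phi2_xi => /(congr1 eta).
  by rewrite eta0 etaZ.
by rewrite phi_xiE (smooth_fun_sqr_eq0 _ aa0) scale0r.
Qed.

(** At [Y = xi] the left side of the compatibility of [g] with [phi] vanishes, since
    [phi xi = 0]. *)
Lemma metric_xi X : g X xi = eta X.
Proof.
have := acm_g_phi S X xi.
by rewrite phi_xi acm_eta_xi mulr1 gC metric0l => /esym/subr0_eq.
Qed.

Section kenmotsu_connection.
Hypothesis kenmotsuS : kenmotsu S.
Variable D : connection M.
Hypothesis levi_civitaD : levi_civita (acm_g S) D.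

Lemma tilde_nabla_xi X : tilde_nabla S D X xi = - (eta X + eta X) *: xi.
Proof.
rewrite /tilde_nabla kenmotsuS // acm_eta_xi scale1r metric_xi.
by rewrite (addrAC X) subrr add0r scaleNr scalerDl opprD.
Qed.

(** This is [d eta = 0] in Koszul form. *)
Lemma eta_closed X Y : lie X (eta Y) - lie Y (eta X) = eta (bracket X Y).
Proof.
have [torsion compat] := levi_civitaD.
(* The parenthesis is the covariant derivative of [eta]. It is symmetric in [Z] and [W], so it
   cancels below and leaves [eta (D X Y) - eta (D Y X)]. *)
have lie_eta Z W : lie Z (eta W) = eta (D Z W) + (g Z W - eta Z * eta W).
  rewrite -[eta W]metric_xi compat kenmotsuS // !metric_xi gC.
  by rewrite metricBl metricZl (gC S xi) !metric_xi.
rewrite !lie_eta (gC S Y X) (mulrC (eta Y)) opprD addrACA subrr addr0.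
by rewrite -torsion -!metric_xi metricBl.
Qed.

End kenmotsu_connection.
End almost_contact.

Theorem theorem3p1 (R : realType) (n : nat) (n_ge1 : (1 <= n)%N)
    (M : manifold R (2 * n + 1)%N) (S : almost_contact_metric M)
    (kenmotsuS : kenmotsu S)
    (D : connection M) (levi_civitaD : levi_civita (acm_g S) D) :
  irregular S (tilde_connection S D).
Proof.
move=> X Y; rewrite /curvature.
set T := tilde_connection S D; set eta := form_app (acm_eta S).
have T_xi Z : T Z (acm_xi S) = - (eta Z + eta Z) *: acm_xi S.
  exact: tilde_nabla_xi.
(* All three curvature terms are multiples of [xi], so it suffices that the total coefficient
   vanishes. *)
rewrite !T_xi !nabla_leibniz !T_xi !scalerA -!scalerDl -!scalerBl.
rewrite !lieN !lieD -[eta (bracket X Y)](eta_closed S kenmotsuS D levi_civitaD).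
rewrite -[RHS](scale0r (acm_xi S)); congr (_ *: _).
(* In the commutative ring of smooth functions this reads
   [(4ab - 2c) - (4ab - 2d) + 2(c - d) = 0]. *)
rewrite -/eta; move: (eta X) (eta Y) (lie X _) (lie Y _) => a b c d.
rewrite !mulrNN (mulrC (b + b)) opprB addrC opprK [X in _ + X]addrC subrKA.
by rewrite [X in X + _]addrACA -opprD subrKA subrr.
Qed.
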